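(* Let $X$ be a countably infinite set and let $f:X\to X$ be a map satisfying the bounded condition. Let $\mathcal{H}$ be a complex Hilbert space with orthonormal basis $\{e_x\}_{x\in X}$, and let $T\in\mathcal{B}(\mathcal{H})$ be the bounded linear operator determined by $Te_x=e_{f(x)}$ for all $x\in X$. If $C^{*}(T)$ has no non-trivial reducing subspaces, then $x\sim y$ for every $x,y\in X$.
   Context: $f$ satisfies the bounded condition if there are $k\in\{1,2,\dots\}$ and pairwise disjoint subsets $X_1,\dots,X_k$ of $X$ with $\bigcup_{i=1}^k X_i=X$ such that $f|_{X_i}$ is injective for $1\le i\le k$. The orbit of $x$ is $\operatorname{orb}(x;f)=\{f^n(x)\mid n\ge 0\}$, with $f^0=\mathrm{id}_X$, and $\sim$ is the orbit equivalence relation by $f$: $x\sim y$ iff $\operatorname{orb}(x;f)\cap\operatorname{orb}(y;f)\neq\emptyset$. The operator $T$ is well defined and bounded because each $f^{-1}(x)$ has at most $k$ elements; explicitly $T(\sum_x a_x e_x)=\sum_{x}\big(\sum_{y\in f^{-1}(x)}a_y\big)e_x$. $\mathcal{B}(\mathcal{H})$ is the algebra of bounded linear operators on $\mathcal{H}$. A $C^*$-algebra in $\mathcal{B}(\mathcal{H})$ is a norm-closed linear subspace closed under products and adjoints; $C^*(T)$ is the $C^*$-algebra generated by $T$, i.e. the smallest one containing $T$. A reducing subspace of a $C^*$-algebra $\mathcal{A}\subseteq\mathcal{B}(\mathcal{H})$ is a closed subspace $\mathcal{M}\subseteq\mathcal{H}$ with $S\mathcal{M}\subseteq\mathcal{M}$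 and $S^*\mathcal{M}\subseteq\mathcal{M}$ for all $S\in\mathcal{A}$; the trivial ones are $\{0\}$ and $\mathcal{H}$. *)

(* Defs.v *)
From mathcomp Require Export all_boot all_order all_algebra.
From mathcomp Require Export complex.
From mathcomp Require Export all_classical all_reals all_analysis.
Export Order.TTheory GRing.Theory Num.Theory numFieldNormedType.Exports.

Set Implicit Arguments.
Unset Strict Implicit.
Unset Printing Implicit Defensive.

Local Open Scope classical_set_scope.
Local Open Scope ring_scope.

Definition bounded_condition (X : Type) (f : X -> X) : Prop :=
  exists k : nat, (0 < k)%N /\
  exists P : 'I_k -> set X,
    [/\ trivIset setT P,
        \bigcup_(i in setT) P i = setT
      & forall i, set_inj (P i) f].

Definition orb (X : Type) (f : X -> X) (x : X) : set X :=
  [set iter n f x | n in [set: nat]].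

Definition orbit_equiv (X : Type) (f : X -> X) (x y : X) : Prop :=
  (orb f x `&` orb f y) !=set0.

Section HilbertSpace.
Context (R : realType) (H : completeNormedModType R[i]).

(* [dot] is linear in its first argument and conjugate-linear in its second.
   With [norm_from_dot], [H] is a complex Hilbert space: completeness is part
   of [completeNormedModType]. *)
Definition norm_from_dot (dot : {dot H for Num.conj}) : Prop :=
  forall u : H, `|u| = sqrtC (dot u u).

Definition linear_span (I : Type) (e : I -> H) : set H :=
  [set v | exists (s : seq I) (a : I -> R[i]), v = \sum_(i <- s) a i *: e i].

Definition orthonormal_basis (dot : {dot H for Num.conj})
    (I : Type) (e : I -> H) : Prop :=
  [/\ forall i, dot (e i) (e i) = 1,
      forall i j, i <> j -> dot (e i) (e j) = 0
    & closure (linear_span e) = setT].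

(* Operators are functions [H -> H], with the pointwise linear structure. *)
Definition bounded_operators : set (H -> H) :=
  [set S | linear S /\ exists M : R[i], forall u, `|S u| <= M * `|u|].

(* The norm of [H] takes (nonnegative real) values in [R[i]], hence the [Re]. *)
Definition op_norm (S : H -> H) : R :=
  sup [set complex.Re `|S u| | u in [set u : H | `|u| <= 1]].

Definition norm_closed (A : set (H -> H)) : Prop :=
  forall S, bounded_operators S ->
    (forall eps : R, 0 < eps -> exists2 S', A S' & op_norm (S - S') < eps) ->
    A S.

(* [is_adjoint dot S S'] says S' = S^*: every bounded operator has exactly one
   such S', which is again a bounded operator. *)
Definition is_adjoint (dot : {dot H for Num.conj}) (S S' : H -> H) : Prop :=
  forall u v, dot (S u) v = dot u (S' v).

Definition cstar_algebra (dot : {dot H for Num.conj}) (A : set (H -> H))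
  : Prop :=
  [/\ A `<=` bounded_operators,
      submod_closed [in A],
      forall S S', A S -> A S' -> A (S \o S'),
      forall S S', A S -> is_adjoint dot S S' -> A S'
    & norm_closed A].

Definition cstar_generated (dot : {dot H for Num.conj}) (T : H -> H) :
    set (H -> H) :=
  smallest (cstar_algebra dot) [set T].

Definition reducing_subspace (dot : {dot H for Num.conj})
    (A : set (H -> H)) (M : set H) : Prop :=
  [/\ submod_closed [in M],
      closed M,
      forall S, A S -> S @` M `<=` M
    & forall S S', A S -> is_adjoint dot S S' -> S' @` M `<=` M].

End HilbertSpace.

(* Main.v *)
(* For a set C of basis indices with C = f^-1(C), the closed span M of
   {e_x | x in C}, described as the vectors orthogonal to every other e_x, and
   its orthogonal complement are both T-invariant.  The bounded operators
   leaving M and its complement invariant form a C*-algebra, so they contain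
   C*(T) and M is reducing.  Taking for C the orbit class of x, M is neither
   {0} nor, unless C is everything, the whole space. *)
Require Import Defs.

Local Open Scope classical_set_scope.
Local Open Scope card_scope.
Local Open Scope ring_scope.

(** * Inner product estimates and bounded operators *)

Section HilbertSpace.
Context (R : realType) (H : completeNormedModType R[i]).
Context (dot : {dot H for Num.conj}) (hdot : norm_from_dot dot).

Lemma eq0_small (x K : R[i]) :
  0 <= K -> (forall eps, 0 < eps -> `|x| <= K * eps) -> x = 0.
Proof.
move=> K0 h; apply/eqP; apply: contraT => x0.
(* The bound at eps = |x| / (K + 1) reads |x| (K + 1) <= K |x|, forcing x = 0; adding 1 keeps the
   divisor positive when K = 0. *)
have K1 : 0 < K + 1 by rewrite ltr_wpDl.
have /h : 0 < `|x| / (K + 1) by rewrite divr_gt0 // normr_gt0.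
rewrite mulrA ler_pdivlMr // mulrDr mulr1 mulrC gerDl => hx.
by move: hx; rewrite normr_le0 (negPf x0).
Qed.

Lemma dotC (u v : H) : dot u v = (dot v u)^*.
Proof. by rewrite (hermC dot) /= expr0 mul1r. Qed.

Lemma dotB (u v w : H) : dot (u - v) w = dot u w - dot v w.
Proof. exact: linearBl. Qed.

Lemma dotP (a : R[i]) (u v w : H) :
  dot (a *: u + v) w = a * dot u w + dot v w.
Proof. by rewrite linearPl. Qed.

Lemma dotPr (a : R[i]) (u v w : H) :
  dot w (a *: u + v) = a^* * dot w u + dot w v.
Proof. by rewrite linearPr. Qed.

Lemma dot_norm (u : H) : dot u u = `|u| ^+ 2.
Proof. by rewrite hdot sqrtCK. Qed.

(** With [w] the component of [u] orthogonal to [v], the product of [w] and [u] equals that of [w]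
    with itself, hence is nonnegative; expanding it gives the squared inequality. *)
Lemma cauchy_schwarz (u v : H) : `|dot u v| <= `|u| * `|v|.
Proof.
have [->|v0] := eqVneq v 0.
  by rewrite linear0r normr0 mulr_ge0.
have nv : 0 < `|v| by rewrite normr_gt0.
have nv2 : 0 < `|v| ^+ 2 by rewrite exprn_gt0.
rewrite -(ler_pXn2r (n := 2)) ?nnegrE ?mulr_ge0 // exprMn.
set c := dot u v; pose w := u - (c / `|v| ^+ 2) *: v.
have wv : dot w v = 0.
  by rewrite dotB linearZl_LR /= dot_norm divfK ?subrr // gt_eqF.
have : 0 <= dot w u.
  suff -> : dot w u = dot w w by rewrite dot_norm exprn_ge0.
  by rewrite {3}/w linearBr linearZr_LR /= wv mulr0 subr0.
rewrite dotB linearZl_LR /= dot_norm (dotC v u) -/c mulrAC -normCK.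
by rewrite subr_ge0 ler_pdivrMr.
Qed.

Lemma bounded_ge0 {S : H -> H} : bounded_operators S ->
  exists2 K : R[i], 0 <= K & forall u, `|S u| <= K * `|u|.
Proof.
(* K |u| dominates a norm, so it is nonnegative and equals its own modulus |K| |u|. *)
move=> [_ [K hK]]; exists `|K| => // u.
have h := hK u; apply: (le_trans h).
by rewrite -(ger0_norm (le_trans (normr_ge0 _) h)) normrM normr_id.
Qed.

Lemma bounded_lincomb (a : R[i]) (S S' : H -> H) :
  bounded_operators S -> bounded_operators S' ->
  bounded_operators (a *: S + S').
Proof.
move=> bS bS'; have [K K0 hK] := bounded_ge0 bS.
have [K' K'0 hK'] := bounded_ge0 bS'; case: bS bS' => lS _ [lS' _].
split=> [b u v|]; last first.
  exists (`|a| * K + K') => u; apply: (le_trans (ler_normD _ _)).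
  by rewrite mulrDl lerD // normrZ -mulrA ler_wpM2l.
rewrite !fctE lS lS' !scalerDr !scalerA (mulrC a b) -!addrA; congr (_ + _).
by rewrite addrCA.
Qed.

Lemma bounded0 : bounded_operators (0 : H -> H).
Proof.
split=> [a u v|]; first exact/esym/(etrans (addr0 _))/scaler0.
by exists 0 => u; rewrite mul0r normr_le0.
Qed.

Lemma bounded_comp (S S' : H -> H) :
  bounded_operators S -> bounded_operators S' -> bounded_operators (S \o S').
Proof.
move=> bS bS'; have [K K0 hK] := bounded_ge0 bS.
case: bS bS' => lS _ [lS' [K' hK']]; split=> [a u v|] /=.
  by rewrite lS' lS.
by exists (K * K') => u; rewrite -mulrA (le_trans (hK _)) // ler_wpM2l.
Qed.

(** Linearity: the defect is orthogonal to every vector, hence to itself. Boundedness: |S'v|^2 is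
    the product of SS'v and v, at most K |S'v| |v|, and |S'v| cancels. *)
Lemma bounded_adjoint {S S' : H -> H} :
  bounded_operators S -> is_adjoint dot S S' -> bounded_operators S'.
Proof.
move=> bS adj; have [K K0 hK] := bounded_ge0 bS.
split=> [a u v|].
  apply/eqP; rewrite -subr_eq0 -(dnorm_eq0 dot); apply/eqP.
  by rewrite linearBr /= dotPr -!adj -dotPr subrr.
exists K => v; have [->|nz] := eqVneq (S' v) 0.
  by rewrite normr0; exact: le_trans (hK v).
have n0 : 0 < `|S' v| by rewrite normr_gt0.
rewrite -(ler_pM2l n0) -expr2 -dot_norm -adj.
have := cauchy_schwarz (S (S' v)) v.
rewrite adj dot_norm normrX normr_id => h; apply: (le_trans h).
by rewrite mulrA ler_wpM2r // mulrC.
Qed.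

Lemma op_normP (S : H -> H) (u : H) : bounded_operators S ->
  `|S u| <= (op_norm S)%:C%C * `|u|.
Proof.
move=> bS; have [K K0 hK] := bounded_ge0 bS; case: bS => lS _.
have [->|u0] := eqVneq u 0.
  by have := hK 0; rewrite normr0 !mulr0.
have nu : `|u| != 0 by rewrite normr_eq0.
(* By homogeneity it suffices to bound S at this unit vector, whose image norm belongs to the set
   defining the supremum. *)
pose w := `|u|^-1 *: u.
have S0 : S 0 = 0 by have := lS (-1) 0 0; rewrite scaler0 addr0 scaleN1r addNr.
have -> : S u = `|u| *: S w.
  by rewrite -[RHS]addr0 -[X in _ + X]S0 -lS addr0 scalerA mulfV ?scale1r.
have w1 : `|w| = 1 by rewrite normrZ normfV normr_id mulVf.
rewrite normrZ normr_id mulrC ler_wpM2r //.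
(* A nonnegative element of [R[i]] is real, so taking [Re] in [op_norm] loses nothing. *)
have ReP (x : R[i]) : 0 <= x -> x = (complex.Re x)%:C%C.
  by case: x => a b /=; rewrite lecE /= => /andP[/eqP -> _].
rewrite [leLHS]ReP // lecR; apply: ub_le_sup; last first.
  by exists w => //=; rewrite w1.
exists (complex.Re K) => _ [v /= v1 <-].
by rewrite -lecR -!ReP // (le_trans (hK v)) // ler_piMr.
Qed.


Lemma bounded_id : bounded_operators (id : H -> H).
Proof. by split=> //; exists 1 => u; rewrite mul1r. Qed.

(** * Vectors supported on a set of basis indices *)

Context (X : Type) (e : X -> H) (he : orthonormal_basis dot e).

Definition supported (C : set X) : set H :=
  [set v | forall x, ~ C x -> dot v (e x) = 0].

Lemma norm_basis x : `|e x| = 1.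
Proof.
case: he => e1 _ _; apply/eqP; rewrite -(pexpr_eq1 (n := 2)) //.
by rewrite -dot_norm e1.
Qed.

Lemma supported_basis {C : set X} {x} : C x -> supported C (e x).
Proof. by move=> Cx y nCy; case: he => _ + _; apply => xy; subst. Qed.

Lemma supported_lincomb (C : set X) (a : R[i]) (u v : H) :
  supported C u -> supported C v -> supported C (a *: u + v).
Proof. by move=> uC vC x nCx; rewrite dotP uC // vC // mulr0 addr0. Qed.

Lemma supported_sum (C : set X) (s : seq X) (a : X -> R[i]) :
  supported C (\sum_(i <- s | i \in C) a i *: e i).
Proof.
elim/big_rec: _ => [x _|i v /set_mem Ci vC]; first by rewrite linear0l.
exact/supported_lincomb/vC/supported_basis.
Qed.

(* Pythagoras: discarding the part of an approximant outside [C] only brings it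
   closer to [v]. *)
Lemma supported_approx {C : set X} {v : H} {eps : R[i]} :
  supported C v -> 0 < eps ->
  exists s (a : X -> R[i]), `|v - \sum_(i <- s | i \in C) a i *: e i| < eps.
Proof.
move=> vC eps0; case: (he) => _ _ dense.
have : closure (linear_span e) v by rewrite dense.
move=> /(_ (ball v eps) (nbhsx_ballx v eps eps0)) [_ [[s [a ->]]]].
rewrite -ball_normE /= => close; exists s, a; apply: le_lt_trans close.
rewrite [in leRHS](bigID (fun i => i \in C)) /=.
set p := \sum_(i <- s | i \in C) _; set q := \sum_(i <- s | _) _.
have wC : supported C (v - p).
  by rewrite addrC -scaleN1r; apply/supported_lincomb/vC/supported_sum.
have wq : dot (v - p) q = 0.
  rewrite /q linear_sumr /= big1 // => i /negP iC; rewrite linearZr_LR /=.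
  by rewrite wC ?mulr0 // => Ci; apply: iC; rewrite inE.
rewrite -(ler_pXn2r (n := 2)) ?nnegrE // opprD addrA -!dot_norm.
by rewrite (dnormB dot (v - p) q) /= wq conjC0 addr0 subr0 lerDl dnorm_ge0.
Qed.

(** Orthogonality to [w] passes from the S e_i to finite combinations by linearity, then to [S v] by
    [supported_approx], boundedness of S and Cauchy-Schwarz. *)
Lemma dot_supported_eq0 {C : set X} {S : H -> H} {v w : H} :
  bounded_operators S -> supported C v ->
  (forall i, C i -> dot (S (e i)) w = 0) -> dot (S v) w = 0.
Proof.
move=> bS vC Sw; have [K K0 hK] := bounded_ge0 bS; case: bS => lS _.
apply: (@eq0_small _ (K * `|w|)) => [|eps eps0]; first exact: mulr_ge0.
have [s [a /ltW]] := supported_approx vC eps0.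
set p := \sum_(i <- s | _) _ => close.
have S0 : S 0 = 0 by have := lS (-1) 0 0; rewrite scaler0 addr0 scaleN1r addNr.
have Sp : dot (S p) w = 0.
  rewrite /p; elim/big_rec: _ => [|i u /set_mem Ci Su].
    by rewrite S0 linear0l.
  by rewrite lS dotP Sw // Su mulr0 addr0.
have -> : dot (S v) w = dot (S (v - p)) w.
  have -> : v = 1 *: (v - p) + p by rewrite scale1r subrK.
  by rewrite lS dotP Sp mul1r addr0 scale1r addrK.
apply: le_trans (cauchy_schwarz _ _) _.
by rewrite mulrAC ler_wpM2r // (le_trans (hK _)) // ler_wpM2l.
Qed.

Lemma supported_orthogonal {C : set X} {v w : H} :
  supported C v -> supported (~` C) w -> dot v w = 0.
Proof.
move=> vC wC; apply: (dot_supported_eq0 bounded_id vC) => i Ci /=.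
by rewrite dotC wC ?conjC0 //; apply.
Qed.

Lemma supported_closed (C : set X) : closed (supported C).
Proof.
move=> v clv x nCx; apply: (@eq0_small _ 1) => // eps eps0; rewrite mul1r.
have [w [wC]] := clv _ (nbhsx_ballx v eps eps0).
rewrite -ball_normE /= => /ltW close; apply: le_trans close.
have -> : dot v (e x) = dot (v - w) (e x) by rewrite dotB wC ?subr0.
by rewrite (le_trans (cauchy_schwarz _ _)) // norm_basis mulr1.
Qed.

(** Requiring invariance of both summands makes the set stable under adjoints, which exchange the
    two conditions. *)
Definition block_diagonal (C : set X) : set (H -> H) :=
  [set S | [/\ bounded_operators S,
    forall v, supported C v -> supported C (S v)
  & forall v, supported (~` C) v -> supported (~` C) (S v)]].

(** For x outside C, the e_x coefficient of S'v is the product of v and S e_x, and S e_x is still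
    supported off C. *)
Lemma adjoint_supported {C : set X} {S S' : H -> H} {v : H} :
  is_adjoint dot S S' ->
  (forall w, supported (~` C) w -> supported (~` C) (S w)) ->
  supported C v -> supported C (S' v).
Proof.
move=> adj SC vC x nCx; rewrite dotC -adj dotC conjCK.
by apply: (supported_orthogonal vC); apply/SC/supported_basis.
Qed.

Lemma block_diagonal_adjoint {C : set X} {S S' : H -> H} :
  block_diagonal C S -> is_adjoint dot S S' -> block_diagonal C S'.
Proof.
move=> [bS SC SnC] adj; split; first exact: bounded_adjoint adj.
  by move=> v; apply: adjoint_supported adj _.
by move=> v; apply: adjoint_supported adj _; rewrite setCK.
Qed.

Lemma norm_limit_supported (C : set X) (S : H -> H) (v : H) :
  bounded_operators S ->
  (forall eps : R, 0 < eps -> exists S', [/\ bounded_operators S',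
     supported C (S' v) & op_norm (S - S') < eps]) ->
  supported C (S v).
Proof.
move=> bS lim x nCx; apply: (@eq0_small _ `|v|) => // eps eps0.
(* A positive [eps] in [R[i]] is a real [r], at which the operator norm hypothesis applies. *)
case: eps eps0 => r j; rewrite ltcE /= => /andP[/eqP -> r0].
have [S' [bS' S'v /ltW close]] := lim r r0.
have bD : bounded_operators (S - S').
  by rewrite addrC -scaleN1r; apply: bounded_lincomb.
have -> : dot (S v) (e x) = dot ((S - S') v) (e x).
  by rewrite !fctE dotB S'v ?subr0.
rewrite (le_trans (cauchy_schwarz _ _)) // norm_basis mulr1.
by rewrite (le_trans (op_normP _ v bD)) // mulrC ler_wpM2l // lecR.
Qed.

Lemma block_diagonal_cstar (C : set X) : cstar_algebra dot (block_diagonal C).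
Proof.
split=> [S []//| |S S' [bS SC SnC] [bS' S'C S'nC]|S S'|S bS lim].
- split=> [|a S S']; rewrite !inE.
    by split=> [|v _ x _|v _ x _]; [exact: bounded0|rewrite linear0l..].
  move=> [bS SC SnC] [bS' S'C S'nC]; split; first exact: bounded_lincomb.
    by move=> v vC; apply: supported_lincomb; [exact: SC|exact: S'C].
  by move=> v vC; apply: supported_lincomb; [exact: SnC|exact: S'nC].
- split; first exact: bounded_comp.
    by move=> v vC; apply/SC/S'C.
  by move=> v vC; apply/SnC/S'nC.
- exact: block_diagonal_adjoint.
- split=> // v vC; apply: norm_limit_supported => // eps /lim[S' [bS' S'C S'nC] ?].
    by exists S'; split=> //; exact: S'C.
  by exists S'; split=> //; exact: S'nC.
Qed.

Lemma supported_reducing {C : set X} {T : H -> H} : block_diagonal C T ->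
  reducing_subspace dot (cstar_generated dot T) (supported C).
Proof.
move=> TC; have gen : cstar_generated dot T `<=` block_diagonal C.
  by apply: smallest_sub => [|_ ->//]; exact: block_diagonal_cstar.
split.
- split=> [|a u v]; rewrite !inE; first by move=> x _; rewrite linear0l.
  exact: supported_lincomb.
- exact: supported_closed.
- by move=> S /gen[_ SC _] _ [v vC <-]; exact: SC.
- move=> S S' /gen/block_diagonal_adjoint h /h[_ S'C _] _ [v vC <-].
  exact: S'C.
Qed.

Lemma supported_shift {C : set X} {f : X -> X} {T : H -> H} :
  bounded_operators T -> (forall x, T (e x) = e (f x)) ->
  (forall x, C x -> C (f x)) ->
  forall v, supported C v -> supported C (T v).
Proof.
move=> bT Te fC v vC x nCx; apply: (dot_supported_eq0 bT vC) => i Ci.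
by rewrite Te; apply: supported_basis nCx; exact: fC.
Qed.

End HilbertSpace.

(** * Orbit classes and the conclusion *)

Lemma orbit_equiv_shift (X : Type) (f : X -> X) (x y : X) :
  orbit_equiv f x (f y) <-> orbit_equiv f x y.
Proof.
split=> -[z [[n _ xz] [m _ yz]]].
  by exists z; split; [exists n|exists m.+1; rewrite // iterSr].
(* The common point z may be y itself, off the orbit of f y; its image f z lies on both orbits. *)
exists (f z); split; [exists n.+1|exists m] => //; first by rewrite iterS xz.
by rewrite -iterSr iterS yz.
Qed.

Theorem corollary5p1p6
  (R : realType) (X : Type) (hX : [set: X] #= [set: nat])
  (f : X -> X) (hf : bounded_condition f)
  (H : completeNormedModType R[i]) (dot : {dot H for Num.conj})
  (hdot : norm_from_dot dot)
  (e : X -> H) (he : orthonormal_basis dot e)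
  (T : H -> H) (hT : bounded_operators T)
  (hTe : forall x : X, T (e x) = e (f x))
  (hirr : forall M : set H,
     reducing_subspace dot (cstar_generated dot T) M ->
     M = [set 0] \/ M = [set: H]) :
  forall x y : X, orbit_equiv f x y.
Proof.
move=> x y; pose C := [set z | orbit_equiv f x z].
have TC : block_diagonal _ _ dot _ e C T.
  (* Both directions of [orbit_equiv_shift] serve here: one keeps C stable under f, the other its
     complement. *)
  by split=> //; apply: (supported_shift _ _ _ hdot _ _ he hT hTe) => z;
    rewrite /C /= orbit_equiv_shift.
have e1 z : dot (e z) (e z) = 1 by case: he.
have [M0|MT] := hirr _ (supported_reducing _ _ _ hdot _ _ he TC).
  (* The subspace is not zero: it contains the unit vector e_x, as x lies in its own class. *)
  have : supported _ _ dot _ e C (e x).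
    by apply: (supported_basis _ _ _ _ _ he); exists x; split; exists 0%N.
  rewrite M0 => /= ex0; have := e1 x.
  by rewrite ex0 linear0l => /eqP; rewrite eq_sym oner_eq0.
(* If the subspace is everything, then e_y is supported on C; for y outside C it would be orthogonal
   to itself. *)
apply: contrapT => nCy.
have /(_ y nCy) : supported _ _ dot _ e C (e y) by rewrite MT.
by move/eqP; rewrite e1 oner_eq0.
Qed.
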